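(* Let $a,b,n$ be positive integers with $a>b$, and define the truncated $q$-trinomial coefficient \[ \bigg(\!\!\binom{an}{bn}\!\!\bigg)_q'=\sum_{k=0}^{\lfloor n/2\rfloor}q^{k(k+bn)}\begin{bmatrix} an\\ k\end{bmatrix}\begin{bmatrix} an-k\\ bn+k\end{bmatrix}. \] Then \[ \bigg(\!\!\binom{an}{bn}\!\!\bigg)_q'\equiv\begin{bmatrix} an\\ bn\end{bmatrix}\Big\{1-(a-b)\big(1-\theta_n(q)\big)\Big\}\pmod{\Phi_n(q)^2}, \] where \[ \theta_n(q)=\begin{cases} (-1)^m(1+q^m)q^{m(3m-1)/2}, &\text{if } n=3m,\\ (-1)^mq^{m(3m+1)/2}, &\text{if } n=3m+1,\\ (-1)^{m+1}q^{(m+1)(3m+2)/2}, &\text{if } n=3m+2.\end{cases} \]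
   Context: For integers $n,m$, the $q$-binomial coefficient is $\begin{bmatrix} n\\ m\end{bmatrix}=\begin{bmatrix} n\\ m\end{bmatrix}_q=\frac{(1-q^n)(1-q^{n-1})\cdots(1-q^{n-m+1})}{(1-q)(1-q^2)\cdots(1-q^m)}$ if $0\le m\le n$, and $0$ otherwise. $\Phi_n(q)$ denotes the $n$-th cyclotomic polynomial. $\lfloor x\rfloor$ is the integer part of $x$. For rational functions $A(q),B(q)$, $A\equiv B\pmod{\Phi_n(q)^2}$ means $A-B=\Phi_n(q)^2P(q)/Q(q)$ with $P,Q\in\mathbb{Z}[q]$ and $Q$ coprime to $\Phi_n(q)$. *)

(* Defs.v *)
From mathcomp Require Import all_boot all_order all_algebra all_field.

Set Implicit Arguments.
Unset Strict Implicit.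
Unset Printing Implicit Defensive.

Import Order.TTheory GRing.Theory Num.Theory.
Local Open Scope ring_scope.

(* The fraction field of Z[q], i.e. Q(q). *)
Notation ratfun := {fraction {poly int}}.

Local Notation "x %:F" := (tofrac x).

Definition q : ratfun := ('X : {poly int})%:F.

Definition qbinom (n m : int) : ratfun :=
  if (0 <= m) && (m <= n) then
    (\prod_(i < `|m|%N) (1 - q ^ (n - i%:Z)))
      / (\prod_(i < `|m|%N) (1 - q ^+ i.+1))
  else 0.

Definition qtrinom' (a b n : nat) : ratfun :=
  \sum_(0 <= k < (n %/ 2).+1)
    q ^+ (k * (k + b * n)) * qbinom (a * n)%N%:Z k%:Z
      * qbinom ((a * n)%N%:Z - k%:Z) ((b * n)%N%:Z + k%:Z).

(* The three cases are n = 3m, n = 3m+1 and n = 3m+2; all the divisions by 2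
   are exact. *)
Definition theta (n : nat) : ratfun :=
  let m := (n %/ 3)%N in
  match (n %% 3)%N with
  | 0 => (-1) ^+ m * (1 + q ^+ m) * q ^+ ((m * (3 * m - 1)) %/ 2)
  | 1 => (-1) ^+ m * q ^+ ((m * (3 * m + 1)) %/ 2)
  | _ => (-1) ^+ m.+1 * q ^+ ((m.+1 * (3 * m + 2)) %/ 2)
  end.

(* coprimep over int is defined by pseudo-division, so it means having no
   common factor of positive degree; as 'Phi_n is monic, this agrees with
   coprimality in Z[q]. *)
Definition eqmod_Phi_sq (n : nat) (A B : ratfun) : Prop :=
  exists P Q : {poly int},
    coprimep Q 'Phi_n /\ A - B = ('Phi_n ^+ 2)%:F * P%:F / Q%:F.

(* Main.v *)
(* Let c = a - b.  For 0 < k <= n/2 the k-th term of the truncated q-trinomial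
   coefficient, divided by [an choose bn], contains the factor
   1 - q^(cn) = c (1 - q^n)  mod Phi_n^2, so the rest of it only matters modulo
   Phi_n, that is, at a primitive n-th root of unity.  There it coincides with
   the corresponding part of c times
     (-1)^k q^(k(k-1)/2) (1 - q^n) / (1 - q^(n-k)) [n-k choose k],
   and the sum of the latter over 0 <= k <= n/2 is exactly theta_n.  Indeed it
   equals S_n - q^(n-1) S_(n-2), where S_n is the alternating sum of the
   q^(k(k-1)/2) [n-k choose k], and the two q-Pascal rules yield
   S_(n+3) = - q^(n+1) S_n, which evaluates S_n in closed form. *)

Require Import Defs.
From mathcomp Require Import all_boot all_order all_algebra all_field.
From mathcomp Require Import zify ring.
Import Order.TTheory GRing.Theory Num.Theory.
Local Open Scope ring_scope.

(** * Gaussian binomials as integer polynomials *)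

(** Taking a q-Pascal rule as definition keeps the coefficients in Z[q]; [qbin_qpoch] recovers the
    quotient formula without dividing. *)
Fixpoint qbin (n m : nat) : {poly int} :=
  match n, m with
  | _, 0 => 1
  | 0, _.+1 => 0
  | n'.+1, m'.+1 => qbin n' m' + 'X^m * qbin n' m
  end.

Lemma qbin0 n : qbin n 0 = 1.
Proof. by case: n. Qed.

Lemma qbinS n m : qbin n.+1 m.+1 = qbin n m + 'X^(m.+1) * qbin n m.+1.
Proof. by []. Qed.

Lemma qbin_small n m : (n < m)%N -> qbin n m = 0.
Proof.
elim: n m => [|n IH] [|m] //= lt_nm.
by rewrite !IH ?mulr0 ?addr0 // ltnW.
Qed.

Lemma qbinn n : qbin n n = 1.
Proof. by elim: n => //= n ->; rewrite qbin_small ?mulr0 ?addr0. Qed.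

Definition qpoch (n : nat) : {poly int} := \prod_(i < n) (1 - 'X^(i.+1)).

Lemma qpoch0 : qpoch 0 = 1.
Proof. exact: big_ord0. Qed.

Lemma qpochS n : qpoch n.+1 = qpoch n * (1 - 'X^(n.+1)).
Proof. by rewrite /qpoch big_ord_recr. Qed.

Lemma subX_neq0 n : 1 - 'X^(n.+1) != 0 :> {poly int}.
Proof. by rewrite subr_eq0 eq_sym -subr_eq0 -size_poly_eq0 size_XnsubC. Qed.

Lemma qpoch_neq0 n : qpoch n != 0.
Proof. by apply/prodf_neq0 => i _; exact: subX_neq0. Qed.

(** Induction on the total [m + d]; the two Pascal summands recombine through 1 - q^(m+1) + q^(m+1)
    (1 - q^(d+1)) = 1 - q^(m+d+2). *)
Lemma qbin_qpoch m d : qbin (m + d) m * qpoch m * qpoch d = qpoch (m + d).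
Proof.
have [n] := ubnP (m + d); elim: n m d => // n IH [|m] [|d] lt_n.
- by rewrite qbin0 qpoch0 !mul1r.
- by rewrite qbin0 qpoch0 !mul1r.
- by rewrite addn0 qbinn qpoch0 mul1r mulr1.
have IH1 := IH m d.+1; have IH2 := IH m.+1 d.
rewrite addSn qbinS mulrDl mulrDl.
rewrite {1}qpochS (_ : qbin _ m * _ * _ =
   qbin (m + d.+1) m * qpoch m * qpoch d.+1 * (1 - 'X^(m.+1))); last by ring.
rewrite IH1; last by lia.
rewrite (qpochS d) (_ : 'X^(m.+1) * _ * _ * _ =
   'X^(m.+1) * (1 - 'X^(d.+1)) * (qbin (m + d.+1) m.+1 * qpoch m.+1 * qpoch d)); last by ring.
rewrite addnS -addSn IH2; last by lia.
by rewrite qpochS -addnS exprD; ring.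
Qed.

(** The dual Pascal rule. The recursion for [qbin] is not visibly symmetric, so the rule is read off
    the product formula by cancelling q-factorials. *)
Lemma qbinS' n m : qbin n.+1 m.+1 = qbin n m.+1 + 'X^(n - m) * qbin n m.
Proof.
have [lt_nm|le_mn] := ltnP n m.
  by rewrite !qbin_small ?mulr0 ?addr0 //; lia.
case: (leqP n m) => [le_nm|lt_mn].
  have -> : m = n by lia.
  by rewrite !qbinn qbin_small // subnn add0r mulr1.
have [d ->] : exists d, n = (m + d.+1)%N by exists (n - m).-1; lia.
rewrite addKn addnS.
have E0 := qbin_qpoch m.+1 d.+1; have E1 := qbin_qpoch m.+1 d.
have E2 := qbin_qpoch m d.+1.
rewrite !addnS !addSn in E0 E1 E2.
have nz : qpoch m.+1 * qpoch d.+1 != 0 by rewrite mulf_neq0 ?qpoch_neq0.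
apply: (mulIf nz); rewrite mulrA E0.
transitivity ((1 - 'X^(d.+1)) * qpoch (m + d).+1
              + 'X^(d.+1) * (1 - 'X^(m.+1)) * qpoch (m + d).+1).
  by rewrite qpochS -addnS -addSn exprD; ring.
by rewrite -{1}E1 -E2 !qpochS; ring.
Qed.

(** * The alternating sums S_n and their closed form *)

Definition qschur_term (n k : nat) : {poly int} :=
  (-1) ^+ k * 'X^('C(k, 2)) * qbin (n - k) k.

Definition qschur (n : nat) : {poly int} := \sum_(k < n.+1) qschur_term n k.

Lemma qbin_sub_small n k : (n < k.*2)%N -> qbin (n - k) k = 0.
Proof. by move=> lt_nk; rewrite qbin_small //; lia. Qed.

Lemma qschur_term0 n : qschur_term n 0 = 1.
Proof. by rewrite /qschur_term qbin0 !mul1r. Qed.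

(** Terms beyond n/2 vanish, so sums for different n can be aligned over a common range. *)
Lemma qschur_widen n N : (n %/ 2 < N)%N ->
  qschur n = \sum_(k < N) qschur_term n k.
Proof.
have E M : (n %/ 2 < M)%N ->
    \sum_(k < M) qschur_term n k = \sum_(k < (n %/ 2).+1) qschur_term n k.
  move=> lt_M; rewrite (big_ord_widen _ (qschur_term n) lt_M) [RHS]big_mkcond /=.
  apply: eq_bigr => k _; case: ifP => // /negbT le_k.
  by rewrite /qschur_term qbin_sub_small ?mulr0 //; lia.
by move=> lt_N; rewrite /qschur !E //; lia.
Qed.

(* ['X^n] times the sum [qschur n] in which each term is divided by ['X^k]. *)
Definition qschur_aux (n : nat) : {poly int} :=
  \sum_(k < n.+2) (-1) ^+ k * 'X^('C(k, 2) + (n - k)) * qbin (n - k) k.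

(** By [qbinS'], term j+1 on the left splits into term j+1 of S_(n+1) and minus term j of
    [qschur_aux n]. *)
Lemma qschurSS n : qschur n.+2 = qschur n.+1 - qschur_aux n.
Proof.
rewrite (@qschur_widen n.+1 n.+3); last by lia.
rewrite /qschur /qschur_aux [in LHS]big_ord_recl [X in _ = X - _]big_ord_recl.
rewrite !qschur_term0 -addrA -sumrB; congr (_ + _).
apply: eq_bigr => -[j /= lt_j] _; rewrite /bump /= add1n /qschur_term !subSS.
have [le_jn|lt_nj] := leqP j n; last first.
  by rewrite !qbin_small ?mulr0 ?subr0 //; lia.
rewrite subSn // qbinS' binS bin1 exprS.
(* If n < 2j, the exponent [n - j - j] is truncated, but its coefficient is zero. *)
have [le_2j|lt_2j] := leqP j (n - j); last first.
  by rewrite (@qbin_small (n - j) j) // !mulr0 !addr0 subr0.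
have -> : 'X^('C(j, 2) + (n - j)) = 'X^('C(j, 2)) * 'X^(n - j - j) * 'X^j :> {poly int}.
  by rewrite -!exprD; congr ('X^_); lia.
by rewrite exprD; ring.
Qed.

(** Here the defining Pascal rule applies: the pieces of term j+1 are multiples of term j+1 of
    S_(n+1) and of term j of S_n. *)
Lemma qschur_auxS n : qschur_aux n.+2 = 'X^(n.+2) * qschur n.+1 - 'X^(n.+1) * qschur n.
Proof.
rewrite (@qschur_widen n.+1 n.+4) ?(@qschur_widen n n.+3); [|lia..].
rewrite /qschur_aux ![\sum_(k < n.+4) _]big_ord_recl mulrDr qschur_term0 qbin0 /=.
rewrite !mulr_sumr -addrA -sumrB; congr (_ + _); first by rewrite !(mul1r, mulr1).
apply: eq_bigr => -[j /= lt_j] _; rewrite /bump /= add1n /qschur_term !subSS.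
have [le_jn|lt_nj] := leqP j n; last first.
  by rewrite !qbin_small ?mulr0 ?subr0 //; lia.
rewrite subSn // qbinS binS bin1.
have -> : 'X^('C(j, 2) + j + (n - j).+1) = 'X^('C(j, 2)) * 'X^(n.+1) :> {poly int}.
  by rewrite -exprD; congr ('X^_); lia.
by rewrite exprD !exprS; ring.
Qed.

Lemma qschur0 : qschur 0 = 1.
Proof. by rewrite /qschur big_ord1 qschur_term0. Qed.

Lemma qschur1 : qschur 1 = 1.
Proof. by rewrite (@qschur_widen 1 1) // big_ord1 qschur_term0. Qed.

Lemma qschur2 : qschur 2 = 0.
Proof.
rewrite (@qschur_widen 2 2) // big_ord_recl big_ord1 qschur_term0 /qschur_term /=.
by rewrite expr1; ring.
Qed.

Lemma qschur3 : qschur 3 = - 'X.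
Proof.
rewrite (@qschur_widen 3 2) // big_ord_recl big_ord1 qschur_term0 /qschur_term /=.
by rewrite expr1 bin_small // expr0; ring.
Qed.

(** The two preceding recurrences say that S_(n+3) + q^(n+1) S_n does not depend on n; it is zero at
    n = 0. *)
Lemma qschurSSS n : qschur n.+3 = - 'X^(n.+1) * qschur n.
Proof.
elim: n => [|n IH]; first by rewrite qschur3 qschur0 expr1 mulr1.
by rewrite qschurSS qschur_auxS IH; ring.
Qed.

(** A finite form of Euler's pentagonal number theorem: the exponents are the generalized pentagonal
    numbers. *)
Lemma qschur_mod m :
  [/\ qschur (3 * m) = (-1) ^+ m * 'X^((m * (3 * m - 1)) %/ 2),
      qschur (3 * m).+1 = (-1) ^+ m * 'X^((m * (3 * m + 1)) %/ 2)
    & qschur (3 * m).+2 = 0].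
Proof.
elim: m => [|m [IH0 IH1 IH2]].
  by rewrite muln0 qschur0 qschur1 qschur2 !mul1r.
have -> : (3 * m.+1 = (3 * m).+3)%N by lia.
rewrite !qschurSSS IH0 IH1 IH2 mulr0; split => //.
  (* The increment is written as a multiple of 2, so it leaves the floor without a parity
     argument. *)
  rewrite (_ : (m.+1 * _ = (3 * m).+1 * 2 + m * (3 * m - 1))%N); last by nia.
  by rewrite divnMDl // exprD [(-1) ^+ _.+1]exprS; ring.
rewrite (_ : (m.+1 * _ = (3 * m).+2 * 2 + m * (3 * m + 1))%N); last by nia.
by rewrite divnMDl // exprD [(-1) ^+ _.+1]exprS; ring.
Qed.

(** * Theta as a sum of the terms [qlucas] *)

(* Denominator-free form of [(1 - 'X^n) / (1 - 'X^(n - k)) * qbin (n - k) k]. *)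
Definition qlucas (n k : nat) : {poly int} :=
  qbin (n - k) k + 'X^(n - k) * (if k is j.+1 then qbin (n - k.+1) j else 0).

Definition qlucas_sum (n : nat) : {poly int} :=
  \sum_(k < (n %/ 2).+1) (-1) ^+ k * 'X^('C(k, 2)) * qlucas n k.

Lemma qlucas0 n : qlucas n 0 = 1.
Proof. by rewrite /qlucas qbin0 mulr0 addr0. Qed.

(** The second summand of [qlucas], shifted by one index, gives S_n: C(j+1,2) - C(j,2) = j completes
    q^(n+1-j) to q^(n+1). *)
Lemma qlucas_sumSS n : qlucas_sum n.+2 = qschur n.+2 - 'X^(n.+1) * qschur n.
Proof.
rewrite (@qschur_widen n (n %/ 2).+1) // (@qschur_widen n.+2 (n %/ 2).+2); last by lia.
rewrite /qlucas_sum (_ : n.+2 %/ 2 = (n %/ 2).+1)%N; last by lia.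
rewrite [in LHS]big_ord_recl [\sum_(k < (n %/ 2).+2) _]big_ord_recl.
rewrite qlucas0 qschur_term0 !mul1r -addrA mulr_sumr -sumrB.
congr (_ + _); apply: eq_bigr => -[j /= lt_j] _.
rewrite /bump /= add1n /qlucas /qschur_term !subSS binS bin1.
have -> : 'X^(n.+1) = 'X^(n.+1 - j) * 'X^j :> {poly int}.
  by rewrite -exprD; congr ('X^_); lia.
by rewrite exprD [(-1) ^+ _.+1]exprS; ring.
Qed.

(** For n >= 2 the two sums in [qlucas_sumSS] are known. Both survive when 3 divides n, whence the
    factor 1 + q^m; otherwise exactly one vanishes. *)
Lemma theta_qlucas n : (0 < n)%N -> theta n = tofrac (qlucas_sum n).
Proof.
have tofracX i : q ^+ i = tofrac 'X^i by rewrite rmorphXn.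
have signX i : (-1) ^+ i = tofrac ((-1) ^+ i) :> ratfun by rewrite rmorphXn rmorphN1.
case: n => [//|[|n]] _.
  by rewrite /qlucas_sum big_ord1 qlucas0 !mul1r /theta /= !expr0 rmorph1 mulr1.
rewrite qlucas_sumSS /theta.
move: (n.+2 %/ 3)%N (n.+2 %% 3)%N (divn_eq n.+2 3) (ltn_pmod n.+2 (isT : 0 < 3)%N) => m.
case=> [|[|[|//]]] En _; rewrite ?addn0 in En.
- have [j Em] : exists j, m = j.+1 by exists m.-1; lia.
  have -> : n = (3 * j).+1 by lia.
  have [F0 F1 _] := qschur_mod j.
  rewrite qschurSSS F0 F1 !tofracX signX Em -tofrac1 -rmorphD -!rmorphM; congr tofrac.
  rewrite (_ : (j.+1 * (3 * j.+1 - 1) = (3 * j).+1 * 2 + j * (3 * j - 1))%N); last by nia.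
  have <- : (j + j * (3 * j - 1) %/ 2 = j * (3 * j + 1) %/ 2)%N.
    by rewrite -divnMDl //; congr (_ %/ _)%N; nia.
  by rewrite divnMDl // !exprD !exprS; ring.
- have [j Em] : exists j, m = j.+1 by exists m.-1; lia.
  have -> : n = (3 * j).+2 by lia.
  have [_ F1 F2] := qschur_mod j.
  rewrite qschurSSS F1 F2 mulr0 subr0 tofracX signX Em -rmorphM; congr tofrac.
  rewrite (_ : (j.+1 * (3 * j.+1 + 1) = (3 * j).+2 * 2 + j * (3 * j + 1))%N); last by nia.
  by rewrite divnMDl // exprD [(-1) ^+ _.+1]exprS; ring.
have -> : n = (3 * m)%N by lia.
have [F0 _ F2] := qschur_mod m.
rewrite F2 F0 sub0r tofracX signX -rmorphM; congr tofrac.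
rewrite (_ : (m.+1 * (3 * m + 2) = (3 * m).+1 * 2 + m * (3 * m - 1))%N); last by nia.
by rewrite divnMDl // exprD [(-1) ^+ _.+1]exprS; ring.
Qed.

(** * Product formulas for the terms of both sums *)

Lemma qpoch_sub k l m : (k <= l <= m)%N ->
  qpoch (m - k) = qpoch (m - l) * \prod_(k <= i < l) (1 - 'X^(m - i)).
Proof.
elim: l => [|l IH] /andP[le_kl le_lm].
  by rewrite big_geq // mulr1; congr qpoch; lia.
have [->|ne_kl] := eqVneq k l.+1; first by rewrite big_geq // mulr1.
rewrite big_nat_recr /=; last by lia.
rewrite IH; last by lia.
have -> : (m - l = (m - l.+1).+1)%N by lia.
by rewrite qpochS; ring.
Qed.

(** The product starts at k+1 because the factor 1 - q^(n-k) cancels the denominator of the quotient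
    form of [qlucas]. *)
Lemma qlucas_prod n k : (0 < k)%N -> (k.*2 <= n)%N ->
  qlucas n k * qpoch k = (1 - 'X^n) * \prod_(k.+1 <= i < k.*2) (1 - 'X^(n - i)).
Proof.
case: k => [//|j] _ le_jn; apply: (mulIf (qpoch_neq0 (n - j.+1.*2))).
rewrite -[RHS]mulrA [X in _ = _ * X]mulrC -qpoch_sub; last by lia.
rewrite /qlucas; move Ed : (n - j.+1.*2)%N => d.
have -> : (n - j.+1)%N = (j.+1 + d)%N by lia.
have -> : (n - j.+2)%N = (j + d)%N by lia.
have -> : 'X^n = 'X^(j.+1 + d) * 'X^(j.+1) :> {poly int}.
  by rewrite -exprD; congr ('X^_); lia.
transitivity (qbin (j.+1 + d) j.+1 * qpoch j.+1 * qpoch d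
  + 'X^(j.+1 + d) * (1 - 'X^(j.+1)) * (qbin (j + d) j * qpoch j * qpoch d)).
  by rewrite qpochS; ring.
by rewrite !qbin_qpoch addSn qpochS; ring.
Qed.

(** Used with M = bn and D = cn: all binomials become q-factorials, and the factor 1 - q^D,
    divisible by ['Phi_n], is isolated. *)
Lemma qtrinomial_prod M D k : (0 < k)%N -> (k.*2 <= D)%N ->
  qbin (M + D) k * qbin (M + D - k) (M + k)
    * (qpoch k * \prod_(i < k) (1 - 'X^(M + i.+1)))
  = qbin (M + D) M * (1 - 'X^D) * \prod_(1 <= i < k.*2) (1 - 'X^(D - i)).
Proof.
move=> k_gt0 le_kD; set E := \prod_(i < k) _; set V := \prod_(_ <= i < _) _.
have nz : qpoch (M + D - k) * qpoch M * qpoch (D - k.*2) != 0.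
  by rewrite !mulf_neq0 ?qpoch_neq0.
have EM : qpoch (M + k) = qpoch M * E.
  by rewrite /qpoch big_split_ord /=; congr (_ * _); apply: eq_bigr => i _; rewrite addnS.
have VD : qpoch D = qpoch (D - k.*2) * ((1 - 'X^D) * V).
  rewrite -{1}(subn0 D) (@qpoch_sub 0 k.*2) // big_ltn ?subn0 //; lia.
have H1 := qbin_qpoch k (M + D - k).
have H2 := qbin_qpoch (M + k) (D - k.*2).
have H3 := qbin_qpoch M D.
rewrite subnKC in H1; last by lia.
rewrite (_ : M + k + (D - k.*2) = M + D - k)%N in H2; last by lia.
apply: (mulIf nz).
transitivity (qpoch (M + D) * qpoch (M + D - k)).
  by rewrite -{1}H1 -{3}H2 EM; ring.
by rewrite -{1}H3 VD; ring.
Qed.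

(** * Passing between ['Phi_n] and primitive roots of unity *)

(** The remainder modulo the monic ['Phi_n] vanishes at z but has smaller degree than the minimal
    polynomial of z over Q, so it is zero. *)
Lemma Cyclotomic_dvd (n : nat) (z : algC) (p : {poly int}) :
  n.-primitive_root z -> (map_poly intr p).[z] = 0 -> exists r, p = r * 'Phi_n.
Proof.
move=> z_prim pz0; exists (p %/ 'Phi_n).
have Ep := Pdiv.IdomainMonic.divp_eq (Cyclotomic_monic n) p.
have Phi_nz : 'Phi_n != 0 by rewrite monic_neq0 ?Cyclotomic_monic.
have Phi_root : (map_poly intr 'Phi_n).[z] = 0 :> algC.
  by apply/eqP; rewrite (Cintr_Cyclotomic z_prim) -/(root _ z) root_cyclotomic.
suff r0 : p %% 'Phi_n = 0 by rewrite [LHS]Ep r0 addr0.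
have lt_size : (size (p %% 'Phi_n)%R < size 'Phi_n)%N by rewrite ltn_modp.
apply/eqP/negPn/negP => r_nz.
have [m [Em _ m_dvd]] := minCpolyP z.
pose r := map_poly intr (p %% 'Phi_n) : {poly rat}.
have Er : map_poly ratr r = map_poly intr (p %% 'Phi_n) :> {poly algC}.
  by rewrite -map_poly_comp; apply: eq_map_poly => c /=; rewrite ratr_int.
have size_r : size r = size (p %% 'Phi_n) by rewrite size_map_inj_poly //; exact: intr_inj.
have : m %| r.
  rewrite -m_dvd /root Er.
  have := congr1 (fun x => (map_poly intr x).[z] : algC) Ep.
  by rewrite rmorphD rmorphM hornerD hornerM Phi_root mulr0 add0r pz0 => <-.
move/dvdp_leq; rewrite -size_poly_eq0 size_r size_poly_eq0 => /(_ r_nz).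
have -> : size m = size 'Phi_n.
  rewrite -(size_map_poly (ratr : rat -> algC)) -Em (minCpoly_cyclotomic z_prim).
  by rewrite size_cyclotomic size_Cyclotomic.
by rewrite leqNgt lt_size.
Qed.

(** A gcd of positive degree would have a complex root, which is a primitive n-th root of unity and
    a root of p. *)
Lemma coprimep_Cyclotomic (n : nat) (p : {poly int}) : (0 < n)%N ->
  (forall z : algC, n.-primitive_root z -> (map_poly intr p).[z] != 0) ->
  coprimep p 'Phi_n.
Proof.
move=> n_gt0 p_nz; rewrite coprimep_def; set g := gcdp p 'Phi_n.
(* Divisibility over Z holds only up to a nonzero scalar, which does not affect roots. *)
have root_dvd (d r : {poly int}) (z : algC) : d %| r ->
    root (map_poly intr d) z -> root (map_poly intr r) z.
  move=> /Pdiv.Idomain.dvdpP[[c s] /= c_nz] /(congr1 (map_poly (intr : int -> algC))).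
  rewrite rmorphM /= map_polyZ /= => E d_z.
  have : root (intr c *: map_poly intr r) z by rewrite E rootM d_z orbT.
  by rewrite rootZ // intr_eq0.
have -> : size g = size (map_poly (intr : int -> algC) g).
  by rewrite size_map_inj_poly //; exact: intr_inj.
apply/negPn/negP => /closed_rootP[z g_z].
have [w w_prim] := C_prim_root_exists n_gt0.
have z_prim : n.-primitive_root z.
  by rewrite -(root_cyclotomic w_prim) -(Cintr_Cyclotomic w_prim)
     (root_dvd _ _ _ (dvdp_gcdr _ _) g_z).
have /negP[] := p_nz z z_prim.
exact: (root_dvd _ _ _ (dvdp_gcdl _ _) g_z).
Qed.

(** Each factor is 1 - z^(-i) = - z^(-i) (1 - z^i), and k^2 - C(k+1,2) = C(k,2). *)
Lemma prod_subX_unity (R : comNzRingType) (z : R) n k : z ^+ n = 1 -> (k <= n)%N ->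
  z ^+ (k * k) * \prod_(i < k) (1 - z ^+ (n - i.+1))
  = (-1) ^+ k * z ^+ 'C(k, 2) * \prod_(i < k) (1 - z ^+ i.+1).
Proof.
move=> zn1; elim: k => [|k IH] lt_kn; first by rewrite !big_ord0 bin_small // !mulr1.
have Ez : z ^+ k.+1 * z ^+ (n - k.+1) = 1 by rewrite -exprD subnKC.
rewrite !big_ord_recr /= binS bin1 [(-1) ^+ k.+1]exprS [z ^+ (_ + k)]exprD.
transitivity (z ^+ (k * k) * \prod_(i < k) (1 - z ^+ (n - i.+1))
    * (z ^+ k * (z ^+ k.+1 - z ^+ k.+1 * z ^+ (n - k.+1)))).
  rewrite (_ : k.+1 * k.+1 = k * k + k + k.+1)%N; last by nia.
  by rewrite !exprD; ring.
by rewrite Ez IH 1?ltnW //; ring.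
Qed.

Lemma horner_prod_subX (I : Type) (r : seq I) (P : pred I) (f : I -> nat) (z : algC) :
  (map_poly intr (\prod_(i <- r | P i) (1 - 'X^(f i)) : {poly int})).[z]
  = \prod_(i <- r | P i) (1 - z ^+ f i).
Proof.
rewrite rmorph_prod horner_prod; apply: eq_bigr => i _.
by rewrite rmorphB rmorph1 /= map_polyXn !hornerE.
Qed.

(** * Congruence modulo the square of ['Phi_n], term by term *)

(** Divisibility by the square in Z[q] localized at ['Phi_n]; the cofactor Q absorbs the
    denominators cleared by the product formulas. *)
Definition sqdvd (n : nat) (p : {poly int}) : Prop :=
  exists P Q : {poly int}, coprimep Q 'Phi_n /\ p * Q = 'Phi_n ^+ 2 * P.

Lemma sqdvd_sum (I : Type) (r : seq I) (A : pred I) (F : I -> {poly int}) n :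
  (forall i, A i -> sqdvd n (F i)) -> sqdvd n (\sum_(i <- r | A i) F i).
Proof.
move=> dvdF; apply: big_ind => // [|p1 p2 [P1 [Q1 [cQ1 E1]]] [P2 [Q2 [cQ2 E2]]]].
  by exists 0, 1; rewrite coprime1p mul0r mulr0.
exists (P1 * Q2 + P2 * Q1), (Q1 * Q2); split; first by rewrite coprimepMl cQ1.
transitivity (p1 * Q1 * Q2 + p2 * Q2 * Q1); first by ring.
by rewrite E1 E2; ring.
Qed.

(** Multiplied by [qpoch k * E], the difference becomes a binomial times (1 - q^n) H. One ['Phi_n]
    divides 1 - q^n, the other divides H because H vanishes at z. *)
Lemma trinomial_term_congr (b c n k : nat) : (0 < c)%N -> (0 < k)%N -> (k.*2 <= n)%N ->
  sqdvd n ('X^(k * (k + b * n)) * qbin (b * n + c * n) k * qbin (b * n + c * n - k) (b * n + k)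
    - qbin (b * n + c * n) (b * n) * (c%:R * ((-1) ^+ k * 'X^('C(k, 2)) * qlucas n k))).
Proof.
move=> c_gt0 k_gt0 le_kn; have n_gt0 : (0 < n)%N by lia.
have [z z_prim] := C_prim_root_exists n_gt0.
have le_kcn : (k.*2 <= c * n)%N by nia.
have H1 := @qtrinomial_prod (b * n) (c * n) k k_gt0 le_kcn.
have H2 := @qlucas_prod n k k_gt0 le_kn.
set E := \prod_(i < k) _ in H1; set V := \prod_(_ <= i < _) _ in H1.
set U := \prod_(_ <= i < _) _ in H2.
pose G : {poly int} := \sum_(i < c) ('X^n) ^+ i.
have H3 : 1 - 'X^(c * n) = (1 - 'X^n) * G.
  by rewrite mulnC exprM -opprB subrX1 -mulNr opprB.
pose H := 'X^(k * (k + b * n)) * G * V - c%:R * (-1) ^+ k * 'X^('C(k, 2)) * U * E.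
have [P1 EP1] : exists r, 1 - 'X^n = r * 'Phi_n.
  apply: (Cyclotomic_dvd n z _ z_prim).
  by rewrite rmorphB rmorph1 /= map_polyXn !hornerE prim_expr_order ?subrr.
have [P2 EP2] : exists r, H = r * 'Phi_n.
  apply: (Cyclotomic_dvd n z _ z_prim).
  have zn1 := prim_expr_order z_prim.
  have zMn i : z ^+ (i * n) = 1 by rewrite mulnC exprM zn1 expr1n.
  have evX i : (map_poly intr ('X^i : {poly int})).[z] = z ^+ i.
    by rewrite map_polyXn hornerXn.
  have evG : (map_poly intr G).[z] = c%:R.
    rewrite rmorph_sum horner_sum (eq_bigr (fun=> 1)) ?sumr_const ?card_ord //.
    by move=> i _; rewrite -exprM evX mulnC zMn.
  have evE : (map_poly intr E).[z] = \prod_(i < k) (1 - z ^+ i.+1).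
    by rewrite horner_prod_subX; apply: eq_bigr => i _; rewrite exprD zMn mul1r.
  (* At z the exponents cn - i reduce to n - i; the range 1 <= i < 2k is cut after k, where U
     begins. *)
  have evV : (map_poly intr V).[z]
      = \prod_(i < k) (1 - z ^+ (n - i.+1)) * (map_poly intr U).[z].
    rewrite !horner_prod_subX -(big_mkord xpredT (fun i => 1 - z ^+ (n - i.+1))).
    rewrite -(big_add1 _ _ 0 k.+1 xpredT (fun i => 1 - z ^+ (n - i))) -big_cat_nat; [|lia..].
    apply: eq_big_nat => i /andP[_ lt_i]; congr (_ - _).
    rewrite (_ : c * n - i = c.-1 * n + (n - i))%N ?exprD ?zMn ?mul1r //.
    by case: (c) c_gt0 => // c' _; rewrite mulSn; lia.
  have evS : (map_poly intr ((-1) ^+ k : {poly int})).[z] = (-1) ^+ k.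
    by rewrite rmorphXn rmorphN1 horner_exp hornerN hornerC.
  rewrite /H rmorphB !rmorphM rmorph_nat !hornerE /= evG evE evV evS !evX.
  have le_kn' : (k <= n)%N by lia.
  have := prod_subX_unity _ z n k zn1 le_kn'.
  rewrite mulnDr exprD mulnCA mulnA zMn mulr1 => Ek.
  rewrite -polyC_natr hornerC; set u := (map_poly _ U).[z].
  transitivity (c%:R * u * (z ^+ (k * k) * \prod_(i < k) (1 - z ^+ (n - i.+1)))
    - c%:R * u * ((-1) ^+ k * z ^+ 'C(k, 2) * \prod_(i < k) (1 - z ^+ i.+1))).
    by ring.
  by rewrite Ek subrr.
(* At a primitive n-th root w both products have factors 1 - w^(i+1) with 0 < i+1 <= k < n, hence
   nonzero. *)
exists (qbin (b * n + c * n) (b * n) * P1 * P2), (qpoch k * E); split.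
  apply: coprimep_Cyclotomic => // w w_prim.
  rewrite rmorphM hornerM mulf_neq0 // horner_prod_subX; apply/prodf_neq0 => i _.
    rewrite subr_eq0 eq_sym -(prim_order_dvd w_prim) gtnNdvd //.
    by have := ltn_ord i; lia.
  rewrite exprD mulnC exprM (prim_expr_order w_prim) expr1n mul1r.
  rewrite subr_eq0 eq_sym -(prim_order_dvd w_prim) gtnNdvd //.
  by have := ltn_ord i; lia.
set B := qbin _ (b * n) in H1 *; set T := 'X^(k * _).
transitivity (T * (qbin (b * n + c * n) k * qbin (b * n + c * n - k) (b * n + k) * (qpoch k * E))
   - B * c%:R * (-1) ^+ k * 'X^('C(k, 2)) * E * (qlucas n k * qpoch k)); first by ring.
rewrite H1 H2 H3.
transitivity (B * (1 - 'X^n) * H); first by rewrite /H -/T; ring.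
by rewrite EP1 EP2; ring.
Qed.

(** * Transfer to Q(q) and conclusion *)

Lemma qbinom_qbin N m : (m <= N)%N -> qbinom N%:Z m%:Z = tofrac (qbin N m).
Proof.
move=> le_mN; rewrite /qbinom !lez_nat le_mN /=.
have -> : \prod_(i < m) (1 - q ^+ i.+1) = tofrac (qpoch m).
  by rewrite rmorph_prod; apply: eq_bigr => i _; rewrite rmorphB rmorph1 rmorphXn.
have -> : \prod_(i < m) (1 - q ^ (N%:Z - i%:Z)) = tofrac (qbin N m * qpoch m).
  transitivity (tofrac (\prod_(0 <= i < m) (1 - 'X^(N - i)) : {poly int})).
    rewrite big_mkord rmorph_prod; apply: eq_bigr => i _.
    by rewrite rmorphB rmorph1 rmorphXn subzn // ltnW // (leq_trans (ltn_ord i)).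
  congr tofrac; apply: (mulIf (qpoch_neq0 (N - m))).
  have := qbin_qpoch m (N - m); rewrite subnKC // => ->.
  by rewrite -{3}[N]subn0 (@qpoch_sub 0 m) // mulrC.
by rewrite rmorphM mulfK // tofrac_eq0 qpoch_neq0.
Qed.

Theorem theorem1p1 (a b n : nat) (ha : (0 < a)%N) (hb : (0 < b)%N) (hn : (0 < n)%N)
  (hab : (b < a)%N) :
  eqmod_Phi_sq n (qtrinom' a b n)
    (qbinom (a * n)%N%:Z (b * n)%N%:Z
       * (1 - (a%:R - b%:R) * (1 - theta n))).
Proof.
have [c [c_gt0 Ea]] : exists c, (0 < c)%N /\ a = (b + c)%N by exists (a - b)%N; lia.
have le_bn : (b * n <= a * n)%N by rewrite leq_mul2r ltnW ?orbT.
pose t k := 'X^(k * (k + b * n)) * qbin (a * n) k * qbin (a * n - k) (b * n + k).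
have Et : qtrinom' a b n = tofrac (\sum_(k < (n %/ 2).+1) t k).
  rewrite /qtrinom' big_mkord rmorph_sum; apply: eq_bigr => -[k /= lt_k] _.
  (* As 2k <= n <= cn, both q-binomials of the term lie in the range where [qbinom] is the
     quotient. *)
  have le_2k : (b * n + k.*2 <= a * n)%N by rewrite Ea mulnDl leq_add2l; nia.
  rewrite subzn -?PoszD ?qbinom_qbin; [|lia..].
  by rewrite /t !rmorphM rmorphXn.
rewrite Et theta_qlucas // qbinom_qbin // Ea natrD addrAC subrr add0r -Ea.
have [P [Q [cQ E]]] : sqdvd n (\sum_(k < (n %/ 2).+1) t k
    - qbin (a * n) (b * n) * (1 - c%:R * (1 - qlucas_sum n))).
  (* The terms k = 0 are split off: those of both sides equal the binomial itself, and the 1 in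
     [qlucas_sum] cancels inside 1 - c (1 - theta). *)
  rewrite /qlucas_sum !big_ord_recl {1}/t /= qlucas0 qbin0 subn0 addn0 !mul1r.
  set T := \sum_(i < _) t _; set L := \sum_(i < _) (_ * qlucas n _).
  rewrite (_ : _ - _ = T - qbin (a * n) (b * n) * (c%:R * L)); last by ring.
  rewrite !mulr_sumr -sumrB; apply: sqdvd_sum => -[k /= lt_k] _.
  rewrite /bump /= add1n /t Ea mulnDl.
  by apply: trinomial_term_congr => //; lia.
exists P, Q; split=> //.
have Q_nz : tofrac Q != 0.
  rewrite tofrac_eq0; apply: contraTneq cQ => ->.
  by rewrite coprime0p -size_poly_eq1 size_Cyclotomic eqSS -lt0n totient_gt0.
apply: (mulIf Q_nz); rewrite divfK // -rmorphM -E rmorphM; congr (_ * _).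
by rewrite !(rmorphB, rmorphM, rmorph1, rmorph_nat).
Qed.
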